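(* Let $X$ be a Čech-complete space, $M$ a metric space, $Y$ a metrizable separable space and $\Phi\colon X\to Y$ a continuous and quasi-open map. Suppose $G\subseteq C(X,M)$ is a $\mathfrak{B}$-family such that each $g\in G$ factors through $\Phi$, that is, for each $g\in G$ there is a map $\widetilde g\in C(Y,M)$ satisfying $g(x)=(\widetilde g\circ\Phi)(x)$ for all $x\in X$. Then there is a nonempty compact subset $\Delta$ of $X$ and a countably infinite subset $L$ of $G$ such that $L$ is separated by $\Delta$. As a consequence, if $M$ is a Banach space, $G$ contains a countably infinite $M$-interpolation set.
   Context: All topological spaces are assumed to be infinite, completely regular and Hausdorff. $C(X,M)$ is the set of continuous functions from $X$ to $M$; $M^X$ is the set of all functions from $X$ to $M$ with the product (pointwise convergence) topology. A space $X$ is Čech-complete if it is a $G_\delta$-subset of its Stone-Čech compactification. A map $f\colon X\to Y$ between topological spaces is quasi-open when for any (nonempty) open set $U$ in $X$ the image $f(U)$ has nonempty interior. $G\subseteq C(X,M)$ is a $\mathfrak{B}$-family if: (a) $G$ is relatively compact in $M^X$ (its closure in $M^X$ is compact); and (b) there exist a nonempty open set $V$ of $X$ and $\epsilon>0$ such that for every finite collection $\{U_1,\ldots,U_n\}$ of nonempty relatively open sets of $V$ there is $g\in G$ with $\operatorname{diam}(g(U_j))\ge\epsilon$ for all $j\in\{1,\ldots,n\}$. A subset $L\subseteq C(X,M)$ is separated by $\Delta\subseteq X$ if for every subset $A\subseteq L$ there are two closed subsets $D_1,D_2$ of $M$ and a point $x_A\in\Delta$ such that $\operatorname{dist}(D_1,D_2)>0$,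 $\chi(x_A)\in D_1$ for all $\chi\in A$, and $\chi(x_A)\in D_2$ for all $\chi\in L\setminus A$. A subset $L\subseteq C(X,M)\subseteq M^X$ is called an $M$-interpolation set if it is an interpolation set for $C(M^X,M)$: for each function $h\colon L\to M$ with relatively compact range in $M$ there is a continuous map $f\colon M^X\to M$ with $f|_L=h$. *)

(* Defs.v *)
From HB Require Import structures.
From mathcomp Require Import all_boot all_order all_algebra.
From mathcomp Require Import all_classical all_reals all_analysis.
From mathcomp Require Import borel_hierarchy.

Set Implicit Arguments.
Unset Strict Implicit.
Unset Printing Implicit Defensive.

Import Order.TTheory GRing.Theory Num.Theory.
Import numFieldNormedType.Exports.

Local Open Scope classical_set_scope.
Local Open Scope ring_scope.

Section StoneCech.
Context (R : realType) (X : topologicalType).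

Definition unit_interval_maps : set (X -> R) :=
  [set f : X -> R | continuous f /\ range f `<=` `[0, 1]%classic].

Definition unit_cube : topologicalType := {ptws unit_interval_maps -> R}.

Definition stone_cech_embedding (x : X) : unit_cube := fun f => set_val f x.

(* The points of the closure have all their coordinates in [0, 1], so closing
   up in the power of R or in the power of [0, 1] gives the same set. *)
Definition stone_cech : set unit_cube := closure (range stone_cech_embedding).

(* [Gdelta] is taken in the subspace topology of [stone_cech]. *)
Definition Cech_complete : Prop :=
  Gdelta [set p : stone_cech | range stone_cech_embedding (set_val p)].

End StoneCech.

Definition separable (T : topologicalType) : Prop :=
  exists2 A : set T, countable A & dense A.

Definition metrizable (R : realType) (T : topologicalType) : Prop :=
  exists d : T -> T -> R,
    [/\ forall x y, d x y = 0 <-> x = y,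
        forall x y, d x y = d y x,
        forall x y z, d x z <= d x y + d y z &
        forall x, nbhs x =
          filter_from [set e : R | 0 < e] (fun e => [set y | d x y < e])].

Definition quasi_open (X Y : topologicalType) (f : X -> Y) : Prop :=
  forall U : set X, open U -> U !=set0 -> (f @` U)° !=set0.

(* The set C(X, M), as a subset of M^X with its product topology. *)
Definition Cfun (X M : topologicalType) : set {ptws X -> M} :=
  [set g | continuous (g : X -> M)].

(* The notions below refer to a distance [d] that is meant to induce the
   topology of [M]: [mdist] on a metric space, [`|x - y|] on a normed space. *)
Section MetricValued.
Context (R : realType) (X M : topologicalType) (d : M -> M -> R).

Definition diam (A : set M) : \bar R :=
  ereal_sup [set (d xy.1 xy.2)%:E | xy in A `*` A].

(* This is +oo when [A] or [B] is empty. *)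
Definition setdist (A B : set M) : \bar R :=
  ereal_inf [set (d xy.1 xy.2)%:E | xy in A `*` B].

Definition B_family (G : set {ptws X -> M}) : Prop :=
  compact (closure G) /\
  exists V : set X, exists eps : R,
    [/\ open V, V !=set0, 0 < eps &
      forall (n : nat) (U : 'I_n -> set X),
        (forall j, U j !=set0 /\ exists2 W, open W & U j = V `&` W) ->
        exists2 g, G g & forall j, (eps%:E <= diam (g @` U j))%E].

Definition separated_by (L : set {ptws X -> M}) (Delta : set X) : Prop :=
  forall A : set {ptws X -> M}, A `<=` L ->
  exists D1 D2 : set M, exists xA : X,
    [/\ closed D1 /\ closed D2, Delta xA, (0 < setdist D1 D2)%E,
        forall chi, A chi -> D1 (chi xA) &
        forall chi, (L `\` A) chi -> D2 (chi xA)].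

End MetricValued.

(* [h] matters on [L] only: it stands for an arbitrary function L -> M. *)
Definition interpolation_set (X M : topologicalType) (L : set {ptws X -> M}) :
    Prop :=
  forall h : {ptws X -> M} -> M, compact (closure (h @` L)) ->
  exists2 f : {ptws X -> M} -> M,
    continuous f & forall chi, L chi -> f chi = h chi.

Definition factors_through (X Y M : topologicalType) (Phi : X -> Y)
    (g : {ptws X -> M}) : Prop :=
  exists2 gt : Y -> M, continuous gt & forall x, g x = gt (Phi x).

Arguments Cfun X M : clear implicits.

(* Main.v *)
(** The oscillation condition is a property of finite collections of open sets,
    so it drives a Cantor scheme in which a single function g_n of [G] handles a
    whole level: every set U_w with |w| = n is split by g_n into two smaller open
    sets, which g_n maps into D_0 and D_1.  The infinite branches then realise
    all 0-1 sequences, so {g_n} is separated by the compact set of limits of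
    branches; the limits exist because X is Cech-complete.

    For this D_0 and D_1 must not depend on w and n.  As [Phi] is quasi-open and
    [Y] has a countable base, countably many members of [G] already oscillate on
    all finite collections, and their values lie in a separable part of [M].
    By Baire there is a nonempty open set on which all these values lie in
    finitely many small balls, and a pigeonhole argument over the pairs of balls
    fixes one pair at positive distance on a smaller open set.

    If [M] is a Banach space, composing coordinate projections with Urysohn
    functions extends all functions L -> M with finitely many values to [M]^X.
    A function with relatively compact range is a uniform limit of these, and
    radial retractions keep the extended differences as small as on [L]. *)

Require Import Defs.
From HB Require Import structures.
From mathcomp Require Import all_boot all_order all_algebra.
From mathcomp Require Import all_classical all_reals all_analysis.
From mathcomp Require Import lra.

Import Order.TTheory GRing.Theory Num.Theory.
Import numFieldNormedType.Exports.

Local Open Scope classical_set_scope.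
Local Open Scope ring_scope.

Set Implicit Arguments.
Unset Strict Implicit.

(** * Powers with the pointwise topology *)

Lemma continuous_ptws (X T : topologicalType) (I : eqType)
    (f : X -> {ptws I -> T}) :
  (forall i, continuous (fun x => f x i)) -> continuous f.
Proof.
move=> cf x; apply/cvg_sup => i; move: x.
apply/(@continuousP _ (initial_topology (@^~ i))) => A [B oB <-].
by move/continuousP: (cf i) => /(_ B oB).
Qed.

Lemma ptws_eval_continuous (I : eqType) (T : topologicalType) (i : I) :
  continuous (fun f : {ptws I -> T} => f i).
Proof. exact: (@proj_continuous I (fun=> T) i). Qed.

(* Frolik's internal form of Cech-completeness; closing [C n] under subsets
   costs nothing and spares refinements. *)
Definition complete_covers (X : topologicalType) (C : nat -> set (set X)) :=
  [/\ forall n (x : X), exists2 U, nbhs x U & C n U,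
      forall n U V, V `<=` U -> C n U -> C n V &
      forall F : set_system X, ProperFilter F ->
        (forall n, exists2 s : seq (set X),
          forall U : set X, U \in s -> C n U & F (\bigcup_(U in [set` s]) U)) ->
        cluster F !=set0].

(** * Cech-complete spaces *)

Section Frolik.
Context (R : realType) (X : topologicalType).
Context (crX : completely_regular_space X).

Local Notation P := (unit_cube R X).
Local Notation e := (@stone_cech_embedding R X).

Lemma stone_cech_embedding_continuous : continuous e.
Proof. by apply: continuous_ptws => f; case: (set_valP f). Qed.

(** Complete regularity makes [e] an embedding: a function separating [x] from the complement of
    [U°] is one of the coordinates of the cube, and [W] bounds that coordinate. *)
Lemma stone_cech_embedding_nbhs (x : X) (U : set X) : nbhs x U ->
  exists2 W : set P, nbhs (e x) W & e @^-1` W `<=` U.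
Proof.
move=> xU; have clU : closed (~` U°) by exact/open_closedC/open_interior.
have xnU : ~ (~` U°) x by move=> /(_ xU).
have [f [cf f01 fx fU]] := (uniform_separatorP (R := R) _ _).1 (crX clU xnU).
have If : f \in @unit_interval_maps R X by rewrite inE.
pose i : @unit_interval_maps R X := exist _ f If.
exists [set p : P | p i < 1].
  have i1 : nbhs (e x i) [set r : R | r < 1].
    apply: open_nbhs_nbhs; split; first exact: open_lt.
    have -> : e x i = f x by [].
    by rewrite /= (fx (f x)) //=; exists x.
  exact: (@ptws_eval_continuous _ _ i (e x) _ i1).
move=> y /= yi; apply: contrapT => Uy.
have : f y < 1 by [].
suff -> : f y = 1 by rewrite ltxx.
by apply: fU; exists y => // /interior_subset.
Qed.

Lemma stone_cech_compact : compact (@stone_cech R X).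
Proof.
pose Q : set P := [set p | forall i, `[0, 1]%classic (p i)].
have cQ : compact Q.
  exact: (@tychonoff _ (fun=> R) (fun=> `[0, 1]%classic)
    (fun=> @segment_compact _ _ _)).
apply: (subclosed_compact _ cQ); first exact: closed_closure.
have clQ : closed Q.
  have -> : Q = \bigcap_i ((fun p : P => p i) @^-1` `[0, 1]%classic).
    by apply/seteqP; split=> p Qp i => [_|]; exact: Qp.
  apply: closed_bigI => i _; apply: closed_comp => [p _|].
    exact: ptws_eval_continuous.
  exact: itv_closed.
rewrite /stone_cech (closure_id Q).1 //; apply: closure_subset => _ [x _ <-] f.
by have [_] := set_valP f; apply; exists x.
Qed.

(** [C n] collects the sets whose closure in the compactification stays in the open set [B n].
    Closure commutes with finite unions, so a filter with such finite covers clusters at a point of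
    all [B n], that is, of the image of [X]. *)
Lemma Cech_complete_covers : Cech_complete R X ->
  exists C : nat -> set (set X), complete_covers C.
Proof.
move=> [F oF FE].
have /choice [B Bop] : forall n, exists B : set P,
    open B /\ set_val @^-1` B = F n.
  by move=> n; have [B oB <-] := oF n; exists B.
have eS x : @stone_cech R X (e x) by apply: subset_closure; exists x.
have rangeE (p : P) (Sp : @stone_cech R X p) :
    range e p <-> forall n, B n p.
  pose q : @stone_cech R X := exist _ p (mem_set Sp).
  have : range e (set_val q) <-> (\bigcap_i F i) q by rewrite -FE.
  move=> H; split => [/H Hq n|Bp]; last first.
    by apply/H => n _; have [_ <-] := Bop n; exact: Bp.
  by have := Hq n I; have [_ <-] := Bop n.
exists (fun n => [set U | closure (e @` U) `&` @stone_cech R X `<=` B n]).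
split=> [n x|n U V VU UB p [Vp Sp]|G PG GC].
- have Bn : nbhs (e x) (B n).
    apply: open_nbhs_nbhs; split; first exact: (Bop n).1.
    by apply: (rangeE _ (eS x)).1; exists x.
  have [W xW WB'] := @uniform_regular P (e x) _ Bn.
  exists (e @^-1` W); first exact: stone_cech_embedding_continuous.
  move=> p [cp _]; apply: WB'; apply: closure_subset cp.
  exact: image_preimage_subset.
- apply: UB; split => //; apply: closure_subset Vp; exact: image_subset.
have [|p [Sp clp]] := @stone_cech_compact (e @ G) _.
  by apply: (@filterS _ G _ setT) => [x _|]; [exact: eS|exact: filterT].
have [n|x _ xp] := (rangeE p Sp).2.
  have [s sC Gs] := GC n.
  have : closure (\bigcup_(U in [set` s]) closure (e @` U)) p.
    rewrite clusterE in clp; apply: clp.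
    apply: (@filterS _ G) Gs => x [U sU Ux]; exists U => //.
    by apply: subset_closure; exists x.
  rewrite -(closure_id _).1; last first.
    by apply: closed_bigcup => [|U _]; [exact: finite_seq|exact: closed_closure].
  by move=> [U /sC UC Up]; exact: UC.
exists x => A D GA xD.
have [W xW WD] := stone_cech_embedding_nbhs xD.
have [_ [[y Ay <-] Wy]] : (e @` A) `&` W !=set0.
  apply: clp; last by rewrite -xp.
  by apply: (@filterS _ G) GA => y Ay; exists y.
by exists y; split => //; exact: WD.
Qed.

End Frolik.

Section CompleteCovers.
Context (X : topologicalType) (C : nat -> set (set X)).
Context (regX : regular_space X) (CC : complete_covers C).

Lemma complete_covers_shrink n (x : X) (W : set X) : nbhs x W ->
  exists U : set X, [/\ open U, U x, closure U `<=` W & C n (closure U)].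
Proof.
move=> xW; have [CN Csub _] := CC; have [D xD CD] := CN n x.
have [U xU UWD] := regX (filterI xW xD).
have clU : closure U° `<=` W `&` D.
  by apply: subset_trans UWD; apply: closure_subset; exact: interior_subset.
exists U°; split => //; first exact: open_interior.
- by move=> y /clU [].
- by apply: Csub CD => y /clU [].
Qed.

(** The [T n] generate a proper filter that contains a member of each [C n]. The index is shifted
    because [T 0] is the arbitrary start of a construction. *)
Lemma complete_covers_branch (T : nat -> set X) :
  (forall n, T n !=set0) -> (forall n, T n.+1 `<=` T n) ->
  (forall n, C n (T n.+1)) -> exists x, forall n, closure (T n) x.
Proof.
move=> T0 TS CT; have Tle m n : (m <= n)%N -> T n `<=` T m.
  move=> /subnKC <-; elim: (n - m)%N => [|k IH]; first by rewrite addn0.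
  by rewrite addnS => y /TS/IH.
have [_ _ Cc] := CC; pose F := filter_from [set: nat] T.
have FF : ProperFilter F.
  apply: filter_from_proper => //; apply: filter_from_filter; first by exists 0%N.
  move=> i j _ _; exists (maxn i j) => // y Ty.
  by split; [apply: Tle (leq_maxl i j) _ Ty|apply: Tle (leq_maxr i j) _ Ty].
have [n|x Fx] := Cc F FF.
  exists [:: T n.+1] => [U|]; first by rewrite inE => /eqP ->.
  by exists n.+1 => // y Ty; exists (T n.+1) => //=; rewrite inE.
by exists x => n; rewrite clusterE in Fx; apply: Fx; exists n.
Qed.

(** If no [F n] contained an open piece of [V], shrinking open sets could avoid [F 0], [F 1], ... in
    turn, and their limit would be a point of [V] outside all of them. *)
Lemma complete_covers_Baire (V : set X) (F : nat -> set X) :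
  open V -> V !=set0 -> (forall n, closed (F n)) -> V `<=` \bigcup_n F n ->
  exists n U, [/\ open U, U !=set0, U `<=` V & U `<=` F n].
Proof.
move=> oV V0 clF VF; apply: contrapT => noU.
pose good U := [/\ open U, U !=set0 & U `<=` V].
(* Dependent choice: the pair holds the stage and the current open set, and the guard [good] makes
   the relation total. *)
have step (p : nat * set X) : exists U', good p.2 ->
    [/\ good U', closure U' `<=` p.2 `\` F p.1 & C p.1 U'].
  case: p => n U /=; have [[oU U0 UV]|?] := pselect (good U); last by exists set0.
  have [y [Uy nFy]] : (U `\` F n) !=set0.
    apply: contrapT => UF; apply: noU; exists n, U; split => // y Uy.
    by apply: contrapT => nFy; apply: UF; exists y.
  have [|U' [oU' U'y clU' CU']] := @complete_covers_shrink n y (U `\` F n).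
    apply: open_nbhs_nbhs; split=> //.
    by apply: openI => //; exact: closed_openC.
  have [_ Csub _] := CC.
  exists U' => _; split => //; last exact: Csub (@subset_closure _ U') CU'.
  split=> //; first by exists y.
  by move=> z U'z; apply: UV; case: (clU' z (subset_closure U'z)).
have {}/choice [f fP] := step.
pose fix T n := if n is m.+1 then f (m, T m) else V.
have gT n : good (T n).
  by elim: n => [|n /(fP (n, _)) []] //; split.
have TP n : closure (T n.+1) `<=` T n `\` F n /\ C n (T n.+1).
  by have [] := fP (n, T n) (gT n).
have [n|n y Ty|n|x Tx] := @complete_covers_branch T.
- by have [] := gT n.
- by have [/(_ y (subset_closure Ty)) []] := TP n.
- by have [] := TP n.
have [n _ Fnx] : (\bigcup_n F n) x.
  by apply: VF; have [/(_ x (Tx 1%N)) []] := TP 0%N.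
by have [/(_ x (Tx n.+1)) []] := TP n.
Qed.

End CompleteCovers.

(** * Families oscillating on finite collections of open sets *)

Definition nonempty_open_in (X : topologicalType) (V : set X) : set (set X) :=
  [set U | [/\ open U, U !=set0 & U `<=` V]].

Lemma nonempty_open_in_sub (X : topologicalType) (V W U : set X) :
  V `<=` W -> nonempty_open_in V U -> nonempty_open_in W U.
Proof. by move=> VW [oU U0 UV]; split => //; exact: subset_trans VW. Qed.

(* If each of the alternatives [ps] failed on every open subset of V, the
   finite collections witnessing the failures could be nested inside one
   another, and the innermost one would defeat all alternatives at once. *)
Lemma pigeonhole_on_open_set (X : topologicalType) (T : Type) (K : eqType)
    (G : set T) (P : K -> T -> set X -> Prop) (ps : seq K) (V : set X) :
  (forall p g U W, U `<=` W -> P p g U -> P p g W) ->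
  open V -> V !=set0 ->
  (forall s : seq (set X), {in s, forall U, nonempty_open_in V U} ->
     exists2 g, G g & {in s, forall U, exists2 p, p \in ps & P p g U}) ->
  exists2 p, p \in ps & exists2 W, nonempty_open_in V W &
    forall s : seq (set X), {in s, forall U, nonempty_open_in W U} ->
      exists2 g, G g & {in s, forall U, P p g U}.
Proof.
move=> Pmono; elim: ps V => [|p ps IH] V oV V0 VP.
  have [|g _ gP] := VP [:: V]; first by move=> U; rewrite inE => /eqP ->; split.
  by have [p] := gP V (mem_head _ _).
have [pV|] := pselect (forall s : seq (set X),
    {in s, forall U, nonempty_open_in V U} ->
    exists2 g, G g & {in s, forall U, P p g U}).
  by exists p; [exact: mem_head|exists V => //; split].
move=> /existsNP [s /not_implyP [sV nP]].
(* If the alternatives [ps] suffice on some [U0] of the failing collection, the induction continues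
   inside [U0]. *)
have [[U0 [U0s U0P]]|noU] := pselect (exists U0, U0 \in s /\
    forall t : seq (set X), {in t, forall U, nonempty_open_in U0 U} ->
     exists2 g, G g & {in t, forall U, exists2 p, p \in ps & P p g U}).
  have [oU0 U00 U0V] := sV _ U0s.
  have [q qps [W W0 WP]] := IH U0 oU0 U00 U0P.
  exists q; first by rewrite inE qps orbT.
  by exists W => //; exact: nonempty_open_in_sub W0.
have bad U : exists t : seq (set X), U \in s ->
    {in t, forall W, nonempty_open_in U W} /\
    (forall g, G g -> exists2 W, W \in t &
       forall q, q \in ps -> ~ P q g W).
  have [Us|] := boolP (U \in s); last by exists [::].
  have /existsNP [t /not_implyP [tU tP]] :=
    fun H => noU (ex_intro _ U (conj Us H)).
  exists t => _; split => // g Gg; apply: contrapT => noW; apply: tP.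
  exists g => // W Wt; apply: contrapT => noq; apply: noW.
  exists W => // q qps Pq.
  by apply: noq; exists q.
have {}/choice [t tP] := bad.
have [|g Gg gP] := VP (flatten [seq t U | U <- s]).
  move=> W /flatten_mapP [U Us Wt]; have [/(_ W Wt) + _] := tP U Us.
  by apply: nonempty_open_in_sub; case: (sV _ Us).
case: nP; exists g => // U Us; apply: contrapT => nPU.
(* Some [W] inside [U] rules out all of [ps] for [g]; so [p] works on [W], and by monotonicity on
   [U]. *)
have [tU /(_ g Gg) [W Wt nPW]] := tP U Us.
have [|q] := gP W; first by apply/flatten_mapP; exists U.
rewrite inE => /orP [/eqP -> Pq|qps Pq].
  by apply: nPU; apply: Pmono Pq; case: (tU W Wt).
exact: nPW Pq.
Qed.

(** Inside each [T n w] and for each bit [b], the next level shrinks around a point that [g n] sends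
    into [O b]. Each level is a finite union of closed sets of the required class, so the
    intersection of the levels is compact and contains a limit of every branch. *)
Lemma Cantor_scheme (X M : topologicalType) (C : nat -> set (set X))
    (O D : bool -> set M) (G : set {ptws X -> M}) (V : set X) :
  regular_space X -> complete_covers C ->
  (forall b, open (O b)) -> (forall b, O b `<=` D b) -> G `<=` Cfun X M ->
  open V -> V !=set0 ->
  (forall s : seq (set X), {in s, forall U, nonempty_open_in V U} ->
     exists2 g, G g & {in s, forall U b, exists2 x, U x & O b (g x)}) ->
  exists (Delta : set X) (g : nat -> {ptws X -> M}),
    [/\ compact Delta, forall n, G (g n) &
        forall a : nat -> bool, exists2 x, Delta x & forall n, D (a n) (g n x)].
Proof.
move=> regX CC oO OD Gc oV V0 VG.
(* Words grow at the head: [b :: w] is a child of [w]. *)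
pose level n (T : seq bool -> set X) :=
  forall w, size w = n -> nonempty_open_in V (T w).
pose words n : seq (seq bool) := [seq tval t | t <- enum {: n.-tuple bool}].
have wordsP n w : size w = n -> w \in words n.
  by move=> /eqP sw; apply/mapP; exists (Tuple sw); rewrite ?mem_enum.
have words_size n w : w \in words n -> size w = n.
  by move=> /mapP [t _ ->]; rewrite size_tuple.
have step (p : nat * (seq bool -> set X)) :
    exists q : (seq bool -> set X) * {ptws X -> M}, level p.1 p.2 ->
    G q.2 /\ forall w b, size w = p.1 ->
      [/\ nonempty_open_in V (q.1 (b :: w)), C p.1 (closure (q.1 (b :: w))) &
          closure (q.1 (b :: w)) `<=` p.2 w `&` q.2 @^-1` O b].
  case: p => n T /=; have [lT|] := pselect (level n T); last first.
    have [|g _ _] := VG [::]; first by [].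
    by exists (fun=> set0, g).
  have [|g Gg gP] := VG [seq T w | w <- words n].
    by move=> U /mapP [w /words_size sw ->]; exact: lT.
  (* Sets are chosen word by word; words that do not extend a word of length [n] get the default
     [set0]. *)
  have /choice [T' T'P] : forall v : seq bool, exists U : set X,
      forall w b, v = b :: w -> size w = n ->
      [/\ nonempty_open_in V U, C n (closure U) &
          closure U `<=` T w `&` g @^-1` O b].
    move=> [|b w]; first by exists set0.
    have [sw|sw] := eqVneq (size w) n; last first.
      by exists set0 => w1 b1 [_ w1E] w1n; rewrite w1E w1n eqxx in sw.
    have [oT T0 TV] := lT w sw.
    have [|x Tx Obx] := gP (T w) _ b; first by apply/map_f/wordsP.
    have [|U [oU Ux clU CU]] :=
        complete_covers_shrink regX CC n (x := x) (W := T w `&` g @^-1` O b).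
      apply: open_nbhs_nbhs; split => //; apply: openI => //.
      by move/continuousP: (Gc _ Gg); apply.
    exists U => _ _ [<- <-] _; split => //; split => //; first by exists x.
    by move=> y Uy; apply: TV; have [] := clU y (subset_closure Uy).
  exists (T', g) => _; split => //= w b sw; exact: T'P.
have {}/choice [f fP] := step.
pose fix T n := if n is m.+1 then (f (m, T m)).1 else fun=> V.
pose g n := (f (n, T n)).2.
have lT n : level n (T n).
  elim: n => [w _|n IH [|b w] //= [sw]]; first by split.
  by have [_ /(_ w b sw) []] := fP (n, T n) IH.
have gP n : G (g n) by have [] := fP (n, T n) (lT n).
have TP n w b : size w = n -> C n (closure (T n.+1 (b :: w))) /\
    closure (T n.+1 (b :: w)) `<=` T n w `&` g n @^-1` O b.
  by move=> sw; have [_ /(_ w b sw) []] := fP (n, T n) (lT n).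
pose K n := \bigcup_(w in [set` words n]) closure (T n w).
have clK : closed (\bigcap_n K n).
  apply: closed_bigI => n _; apply: closed_bigcup => [|w _]; first exact: finite_seq.
  exact: closed_closure.
exists (\bigcap_n K n), g; split=> //.
(* A filter on the intersection contains [K n.+1], a finite union of members of [C n]; so it
   clusters, and the intersection is closed. *)
- move=> F FF FK; have [_ _ Cc] := CC.
  have [n|x Fx] := Cc F FF.
    exists [seq closure (T n.+1 w) | w <- words n.+1].
      move=> U /mapP [[|b w] /words_size] => [|[sw] ->]; first by [].
      by have [] := TP n w b sw.
    apply: (@filterS _ F) FK => x Kx; have [w ww Tx] := Kx n.+1 I.
    exists (closure (T n.+1 w)) => //.
    exact: map_f.
  exists x; split => //; rewrite [X in X x](closure_id _).1 //.
  by rewrite clusterE in Fx; exact: Fx.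
- move=> a; pose fix w n := if n is m.+1 then a m :: w m else [::].
  have sw n : size (w n) = n by elim: n => //= n ->.
  have [n|n y Ty|n|x Tx] := complete_covers_branch CC (T := fun n => T n (w n)).
  + by have [] := lT n _ (sw n).
  + by have [_ /(_ y (subset_closure Ty)) []] := TP n _ (a n) (sw n).
  + have [_ Csub _] := CC; have [CT _] := TP n _ (a n) (sw n).
    exact: Csub (@subset_closure _ _) CT.
  exists x => [n _|n].
    by exists (w n) => //=; exact: wordsP.
  by apply: OD; have [_ /(_ x (Tx n.+1)) []] := TP n _ (a n) (sw n).
Qed.

(** * Distances and reduction to countably many functions *)

(** The content of [metrizable] for a fixed distance, shared by the metric of [Y], [mdist] and the
    norm. *)
Definition is_distance (R : realType) (T : topologicalType) (d : T -> T -> R) :=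
  [/\ forall x y, d x y = 0 <-> x = y,
      forall x y, d x y = d y x,
      forall x y z, d x z <= d x y + d y z &
      forall x, nbhs x =
        filter_from [set e : R | 0 < e] (fun e => [set y | d x y < e])].

Section Distance.
Context (R : realType) (T : topologicalType) (d : T -> T -> R).
Context (dd : is_distance d).

Lemma distance_refl x : d x x = 0.
Proof. by have [d0 _ _ _] := dd; exact/d0. Qed.

Lemma distance_sym x y : d x y = d y x.
Proof. by have [_ + _ _] := dd. Qed.

Lemma distance_triangle y x z : d x z <= d x y + d y z.
Proof. by have [_ _ + _] := dd. Qed.

Lemma distance_nbhs x (U : set T) :
  nbhs x U <-> exists2 e, 0 < e & forall y, d x y < e -> U y.
Proof. by have [_ _ _ ->] := dd. Qed.

Lemma open_distance x e : open [set y | d x y < e].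
Proof.
rewrite openE => y /= xy; apply/distance_nbhs; exists (e - d x y) => [|z yz].
  by rewrite subr_gt0.
by apply: le_lt_trans (distance_triangle y x z) _; rewrite -ltrBrDl.
Qed.

Lemma closed_distance x e : closed [set y | d x y <= e].
Proof.
rewrite -openC openE => y /= /negP; rewrite -ltNge => xy.
apply/distance_nbhs; exists (d x y - e) => [|z yz /=]; first by rewrite subr_gt0.
apply/negP; rewrite -ltNge; have := distance_triangle z x y.
by rewrite (distance_sym z); lra.
Qed.

End Distance.

Lemma separable_dense_sequence (T : topologicalType) :
  separable T -> [set: T] !=set0 -> exists u : nat -> T, dense (range u).
Proof.
move=> [A /countable_injP [f finj] dA] T0.
have [a0 [Aa0 _]] : A `&` setT !=set0.
  by rewrite setIC; apply: dA => //; exact: openT.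
(* [u n] is the point of [A] numbered [n] by [f], with default [a0]. *)
have /choice [u uP] : forall n, exists a, forall b, A b -> f b = n -> a = b.
  move=> n; have [[b [Ab fb]]|nb] := pselect (exists b, A b /\ f b = n).
    exists b => c Ac fc; apply: finj; rewrite ?inE // fb; exact/esym.
  by exists a0 => b Ab fb; case: nb; exists b.
exists u => O O0 oO; have [a [Oa Aa]] := dA O O0 oO.
by exists a; split => //; exists (f a) => //; exact: uP.
Qed.
Lemma diam_gt (R : realType) (X M : topologicalType) (d : M -> M -> R)
    (g : X -> M) (U : set X) (eps : R) :
  (eps%:E < diam d (g @` U))%E -> exists x y, [/\ U x, U y & eps < d (g x) (g y)].
Proof.
move=> /ereal_sup_gt [_ [[_ _] [[x Ux <-] [y Uy <-]] <-]].
by rewrite lte_fin => xy; exists x, y.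
Qed.

(* Only countably many members of [G] are needed to oscillate on all finite
   collections: on each open U, [Phi] covers a ball of a countable base of [Y],
   and every g in [G] depends on [Phi] only. *)
Lemma countable_oscillating_family (R : realType) (X Y M : topologicalType)
    (dY : Y -> Y -> R) (d : M -> M -> R) (Phi : X -> Y) (G : set {ptws X -> M}) :
  is_distance dY -> separable Y -> [set: Y] !=set0 ->
  continuous Phi -> quasi_open Phi ->
  (forall g, G g -> factors_through Phi g) -> B_family d G ->
  exists V (eps : R) (g : nat -> {ptws X -> M}),
    [/\ open V, V !=set0, 0 < eps, forall k, G (g k) &
      forall s : seq (set X), {in s, forall U, nonempty_open_in V U} ->
        exists k, {in s, forall U, exists x y,
          [/\ U x, U y & eps < d (g k x) (g k y)]}].
Proof.
move=> ddY sepY Y0 cPhi qoPhi GPhi [_ [V [eps [oV V0 eps0 GV]]]].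
have [u du] := separable_dense_sequence sepY Y0.
pose B (p : nat * nat) := [set z | dY (u p.1) z < p.2.+1%:R^-1].
have oB p : open (B p) by exact: open_distance.
have base U : nonempty_open_in V U -> exists p, B p `<=` Phi @` U.
  move=> [oU U0 UV]; have [z /(distance_nbhs ddY) [e e0 eU]] := qoPhi U oU U0.
  have [k ke] : exists k, k.+1%:R^-1 < e / 2.
    have e20 : 0 < e / 2 by rewrite divr_gt0.
    have [k _ /(_ k (leqnn k)) ke] := near_infty_natSinv_lt (PosNum e20).
    by exists k.
  have [|w0 [zu [l _ lE]]] :=
      du [set w | dY z w < k.+1%:R^-1] _ (open_distance ddY _ _).
    by exists z => /=; rewrite (distance_refl ddY) invr_gt0.
  exists (l, k) => w /= uw; apply: eU.
  move: zu ke uw (distance_triangle ddY (u l) z w).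
  rewrite -lE /B /= => zu ke uw tri.
  apply: le_lt_trans tri _; rewrite [ltRHS]splitr.
  by apply: ltrD; [exact: lt_trans zu ke|exact: lt_trans uw ke].
(* [h l] oscillates on the preimages of all balls listed in [l]. A diameter is a supremum, so the
   bound drops to [eps / 2] to obtain actual points. *)
have /choice [h hP] : forall l : seq (nat * nat), exists g, G g /\
    ({in l, forall p, B p `<=` Phi @` V} ->
     {in l, forall p, exists x y, [/\ B p (Phi x), B p (Phi y) &
       eps / 2 < d (g x) (g y)]}).
  move=> l.
  have [lV|nlV] := pselect {in l, forall p, B p `<=` Phi @` V}; last first.
    by have [|g Gg _] := GV 0%N (fun=> setT) => [[]//|]; exists g.
  have [|g Gg gP] := GV (size l)
      (fun j => V `&` Phi @^-1` B (nth (0%N, 0%N) l j)).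
    move=> j; split; last first.
      exists (Phi @^-1` B (nth (0%N, 0%N) l j)) => //.
      by move/continuousP: cPhi; apply.
    have uB : B (nth (0%N, 0%N) l j) (u (nth (0%N, 0%N) l j).1).
      by rewrite /B /= (distance_refl ddY) invr_gt0.
    have [x Vx Phix] := lV _ (mem_nth _ (ltn_ord j)) _ uB.
    by exists x; split => //=; rewrite Phix.
  exists g; split=> // _ p pl.
  have pj : (index p l < size l)%N by rewrite index_mem.
  have [|x [y [[_ Bx] [_ By] xy]]] :=
      @diam_gt _ _ _ d g (V `&` Phi @^-1` B (nth (0%N, 0%N) l (index p l)))
        (eps / 2).
    apply: lt_le_trans (gP (Ordinal pj)); rewrite lte_fin; lra.
  by rewrite nth_index // in Bx By; exists x, y.
exists V, (eps / 2), (fun k => h (odflt [::] (unpickle k))); split=> //.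
- by rewrite divr_gt0.
- by move=> k; have [] := hP (odflt [::] (unpickle k)).
move=> s sV.
have /choice [p pP] : forall U, exists p, U \in s -> B p `<=` Phi @` U.
  move=> U; have [Us|Us] := boolP (U \in s); last by exists (0%N, 0%N).
  by have [p pU] := base U (sV U Us); exists p.
exists (pickle [seq p U | U <- s]) => U Us; rewrite pickleK /=.
have [Gh hosc] := hP [seq p U | U <- s].
have [|x [y [Bx By xy]]] := hosc _ (p U) (map_f p Us).
  move=> _ /mapP [W Ws ->] z /(pP W Ws) [w Ww <-]; exists w => //.
  by have [_ _] := sV W Ws; apply.
(* The two points are replaced by points of [U] with the same images under [Phi], where the function
   takes the same values. *)
have [gt _ hE] := GPhi _ Gh.
have [x' Ux' x'E] := pP U Us _ Bx; have [y' Uy' y'E] := pP U Us _ By.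
by exists x', y'; split => //; rewrite hE (hE y') x'E y'E -!hE.
Qed.

(** By continuity, the values of the factors [gt k] at a dense sequence of [Y], enumerated by coded
    pairs, approximate all values of all [g k]. *)
Lemma dense_in_images (R : realType) (X Y M : topologicalType)
    (d : M -> M -> R) (Phi : X -> Y) (g : nat -> {ptws X -> M}) :
  is_distance d -> separable Y -> [set: Y] !=set0 ->
  (forall k, factors_through Phi (g k)) ->
  exists m : nat -> M, forall k x e, 0 < e -> exists i, d (m i) (g k x) < e.
Proof.
move=> dd sepY Y0 gPhi; have [u du] := separable_dense_sequence sepY Y0.
have /choice [gt gtP] : forall k, exists h : Y -> M,
    continuous h /\ forall x, g k x = h (Phi x).
  by move=> k; have [h ch hE] := gPhi k; exists h.
pose ki n : nat * nat := odflt (0%N, 0%N) (unpickle n).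
exists (fun n => gt (ki n).1 (u (ki n).2)) => k x e e0.
have [cgt gE] := gtP k.
have [||v [xl [l _ lv]]] := du (gt k @^-1` [set z | d (g k x) z < e]).
- by exists (Phi x); rewrite /= -gE (distance_refl dd).
- move/continuousP: cgt => cgt; exact: cgt (open_distance dd _ _).
by exists (pickle (k, l)); rewrite /ki pickleK /= lv (distance_sym dd).
Qed.

(** Evaluation at [x] sends [closure G] onto a compact set, on which local bounds for the index
    combine into a single [N]. *)
Lemma precompact_finite_net (R : realType) (X M : topologicalType)
    (d : M -> M -> R) (G : set {ptws X -> M}) (m : nat -> M) (delta : R) (x : X) :
  is_distance d -> compact (closure G) -> 0 < delta ->
  (forall g e, G g -> 0 < e -> exists i, d (m i) (g x) < e) ->
  exists N, forall g, G g -> exists2 i, (i < N)%N & d (m i) (g x) <= delta.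
Proof.
move=> dd cG delta0 mG.
have /compact_near_coveringP cK :
    compact ((fun g : {ptws X -> M} => g x) @` closure G).
  apply: continuous_compact => //; apply: continuous_subspaceT.
  exact: ptws_eval_continuous.
(* The guard makes the property vacuous near a point that no [m i] approaches within [delta]. *)
pose net (N : nat) v :=
  closure (range m) v -> exists2 i, (i < N)%N & d (m i) v <= delta.
have [v _|N _ /(_ N (leqnn N)) KN] := cK nat \oo net _; last first.
  exists N => g Gg; apply: KN; first by exists g => //; exact: subset_closure.
  move=> U /(distance_nbhs dd) [e e0 eU]; have [i ig] := mG g e Gg e0.
  by exists (m i); split => //; apply: eU; rewrite (distance_sym dd).
have [[i cvi]|ncv] := pselect (exists i, d (m i) v < delta).
  exists ([set w | d (m i) w < delta], [set N | (i < N)%N]) => /=.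
    split; last by exists i.+1.
    by apply: open_nbhs_nbhs; split => //; exact: open_distance.
  by move=> [w N] /= [iw iN] _; exists i => //; exact: ltW.
exists (~` closure (range m), setT) => [/=|[w N] /= [ncw _] /ncw//].
split; last exact: filterT.
apply: open_nbhs_nbhs; split; first exact/closed_openC/closed_closure.
move=> /(_ [set w | d v w < delta]) [|_ [[i _ <-] vi]].
  by apply/(distance_nbhs dd); exists delta.
by apply: ncv; exists i; rewrite (distance_sym dd).
Qed.

(** * Separated sequences *)

Lemma setdist_gt0 (R : realType) (M : topologicalType) (d : M -> M -> R)
    (A B : set M) (c : R) :
  0 < c -> (forall x y, A x -> B y -> c <= d x y) -> (0 < setdist d A B)%E.
Proof.
move=> c0 ABc; apply: (@lt_le_trans _ _ c%:E); first by rewrite lte_fin.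
apply: le_ereal_inf_tmp => _ [[x y] [Ax By] <-]; rewrite lee_fin; exact: ABc.
Qed.

Lemma setdist_disjoint (R : realType) (M : topologicalType) (d : M -> M -> R)
    (A B : set M) :
  (forall x, d x x = 0) -> (0 < setdist d A B)%E -> A `&` B = set0.
Proof.
move=> d0 AB; rewrite -subset0 => x [Ax Bx].
suff : (setdist d A B <= 0)%E by rewrite leNgt AB.
by apply: ereal_inf_lbound; exists (x, x) => //=; rewrite d0.
Qed.

(** Indicator sequences handle every subset of the range. The sequence that is true at [i] only
    forces [h i] to differ from every other [h j], so the range is infinite. *)
Lemma separated_range (R : realType) (X M : topologicalType) (d : M -> M -> R)
    (h : nat -> {ptws X -> M}) (Delta : set X) (D : bool -> set M) :
  (forall x, d x x = 0) -> (forall b, closed (D b)) ->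
  (0 < setdist d (D true) (D false))%E ->
  (forall a : nat -> bool, exists2 x, Delta x & forall n, D (a n) (h n x)) ->
  [/\ Delta !=set0, countable (range h), infinite_set (range h) &
      separated_by d (range h) Delta].
Proof.
move=> d0 clD D0 hD; split.
- by have [x Dx _] := hD (fun=> true); exists x.
- exact: sub_countable (card_image_le _ _) (countableP _).
- have hinj : injective h.
    move=> i j hij; apply/eqP; apply: contrapT => /negP ij.
    have [x _ xD] := hD (fun n => n == i).
    have := xD j; have := xD i; rewrite hij eqxx eq_sym (negbTE ij) => Dt Df.
    have : (D true `&` D false) (h j x) by split.
    by rewrite (setdist_disjoint d0 D0).
  move=> /(finite_preimage (in2W hinj)) fin; apply: infinite_nat.
  by apply: sub_finite_set fin => n _; exists n.
move=> A AL; have [x Dx xD] := hD (fun n => `[< A (h n) >]).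
exists (D true), (D false), x; split=> //.
- move=> chi Achi; have [n _ hn] := AL chi Achi.
  by have := xD n; rewrite hn asboolT.
- by move=> chi [[n _ hn] nA]; have := xD n; rewrite hn asboolF.
Qed.

(** The distance is kept abstract so that metric and Banach targets share the argument. *)
Lemma separated_subset (R : realType) (X Y M : topologicalType)
    (dY : Y -> Y -> R) (d : M -> M -> R) (Phi : X -> Y) (G : set {ptws X -> M}) :
  completely_regular_space X -> Cech_complete R X ->
  is_distance dY -> separable Y -> [set: Y] !=set0 ->
  continuous Phi -> quasi_open Phi -> is_distance d ->
  G `<=` Cfun X M -> B_family d G -> (forall g, G g -> factors_through Phi g) ->
  exists (Delta : set X) (L : set {ptws X -> M}),
    [/\ Delta !=set0, compact Delta, L `<=` G,
        countable L /\ infinite_set L & separated_by d L Delta].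
Proof.
move=> crX cX ddY sepY Y0 cPhi qoPhi dd Gc BG GPhi.
have regX := completely_regular_regular (R := R) crX.
have [C CC] := Cech_complete_covers crX cX.
have [V [eps [g [oV V0 eps0 Gg gV]]]] :=
  countable_oscillating_family ddY sepY Y0 cPhi qoPhi GPhi BG.
have [m mg] := dense_in_images dd sepY Y0 (fun k => GPhi _ (Gg k)).
have clg : compact (closure (range g)).
  have [cG _] := BG; apply: subclosed_compact cG _; first exact: closed_closure.
  by apply: closure_subset => _ [k _ <-].
(* Values more than [eps = 8 * delta] apart have [delta]-close centres at least [6 * delta] apart;
   balls of radius [2 * delta] about these are still at least [2 * delta] apart. *)
pose delta := eps / 8.
have delta0 : 0 < delta by rewrite divr_gt0.
(* At points of [F N] the first [N] centres approximate all [g k]; precompactness at each point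
   makes these closed sets cover [X]. *)
pose F N := \bigcap_k \bigcup_(i in `I_N) (g k @^-1` [set v | d (m i) v <= delta]).
have [N|x _|N [W [oW W0 WV WF]]] := complete_covers_Baire regX CC (F := F) oV V0.
- apply: closed_bigI => k _; apply: closed_bigcup => [|i _]; first exact: finite_II.
  apply: closed_comp => [x _|]; [exact: Gc (Gg k) x|exact: closed_distance].
- have [|N NP] := precompact_finite_net (x := x) dd clg delta0 (m := m).
    by move=> _ e [k _ <-]; exact: mg.
  exists N => // k _; have [|i iN ik] := NP (g k); first by exists k.
  by exists i.
pose near_both (p : nat * nat) (h : {ptws X -> M}) (U : set X) :=
  forall b : bool, exists2 x, U x & d (m (if b then p.1 else p.2)) (h x) <= delta.
(* The alternatives are the finitely many pairs of distant centres; a single pair serves all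
   collections inside [W']. *)
have [|s sW|[i j] + [W' [oW' W'0 W'W] W'P]] :=
  @pigeonhole_on_open_set X _ _ (range g) near_both
  [seq p <- [seq (i, j) | i <- iota 0 N, j <- iota 0 N] |
    eps - 2 * delta <= d (m p.1) (m p.2)] W _ oW W0.
- by move=> p h U U' UU' hU b; have [x Ux xb] := hU b; exists x => //; exact: UU'.
- have [|k kP] := gV s; first by move=> U /sW; exact: nonempty_open_in_sub.
  exists (g k); first by exists k.
  move=> U Us; have [x [y [Ux Uy xy]]] := kP U Us.
  have [_ _ UW] := sW U Us.
  have [i /= iN ix] := WF _ (UW _ Ux) k I; have [j /= jN jy] := WF _ (UW _ Uy) k I.
  exists (i, j); last by move=> [|]; [exists x|exists y].
  rewrite mem_filter /= allpairs_f ?mem_iota // andbT.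
  have := distance_triangle dd (m i) (g k x) (g k y).
  have := distance_triangle dd (m j) (m i) (g k y).
  by rewrite (distance_sym dd (g k x) (m i)) => *; lra.
rewrite mem_filter => /andP [/= ij _].
pose c b := m (if b then i else j).
(* The scheme needs open targets, so the radius grows from [delta] to [2 * delta]. *)
have [b|b v|_ [k _ <-]|s sW'|Delta [h [cD hG hD]]] := @Cantor_scheme X M C
  (fun b => [set v | d (c b) v < 2 * delta])
  (fun b => [set v | d (c b) v <= 2 * delta]) (range g) W' regX CC _ _ _ oW' W'0.
- exact: open_distance.
- exact: ltW.
- exact: Gc.
- have [h Gh hP] := W'P s sW'; exists h => // U Us b.
  have [x Ux xb] := hP U Us b; exists x => //=; apply: le_lt_trans xb _; lra.
have [||Delta0 cL iL sL] := @separated_range R X M d h Delta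
   (fun b => [set v | d (c b) v <= 2 * delta]) (distance_refl dd) _ _ hD.
- by move=> b; exact: closed_distance.
- apply: (@setdist_gt0 _ _ _ _ _ delta) => // x y /= xi yj.
  have := distance_triangle dd x (m i) (m j).
  have := distance_triangle dd y x (m j).
  move: yj; rewrite (distance_sym dd _ y); rewrite /c /delta in xi ij * => *; lra.
exists Delta, (range h); split => //.
by move=> _ [n _ <-]; have [k _ <-] := hG n.
Qed.

(** * Interpolation in Banach spaces *)

Lemma compact_finite_net (R : realType) (M : normedModType R)
    (K : set M) (e : R) : compact K -> 0 < e ->
  exists s : seq M, forall v, K v -> exists2 w, w \in s & `|v - w| < e.
Proof.
rewrite compact_cover => cK e0.
have [v _|v Kv|D _ KD] := cK M setT (fun w => ball w e).
- exact: ball_open.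
- by exists v => //; exact: ballxx.
exists (finmap.enum_fset D) => v Kv; have [w Dw wv] := KD v Kv; exists w => //.
by move: wv; rewrite -ball_normE /= distrC.
Qed.

(** Letting [m] tend to infinity bounds the distance from [S n] to the limit by [e n] uniformly,
    which preserves continuity. *)
Lemma uniformly_Cauchy_continuous_limit (R : realType) (T : topologicalType)
    (M : completeNormedModType R) (S : nat -> T -> M) (e : nat -> R) :
  (forall n, continuous (S n)) -> e @ \oo --> 0 ->
  (forall n m z, (n <= m)%N -> `|S n z - S m z| <= e n) ->
  exists2 f : T -> M, continuous f & forall z, (fun n => S n z) @ \oo --> f z.
Proof.
move=> cS e0 Se.
have e_small r : 0 < r -> exists n, e n < r.
  move=> r0; have /cvgr0_norm_lt /(_ r r0) [n _ /(_ n (leqnn n)) en] := e0.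
  by exists n; exact: le_lt_trans (ler_norm _) en.
have Scvg z : cvg ((fun n => S n z) @ \oo).
  apply/cauchy_cvgP/cauchyP => r r0; have [n en] := e_small r r0.
  exists (S n z), n => // m nm; rewrite -ball_normE /=.
  exact: le_lt_trans (Se _ _ z nm) en.
pose f z := limn (fun n => S n z).
have Sf n z : `|S n z - f z| <= e n.
  have : (fun m => `|S n z - S m z|) @ \oo --> `|S n z - f z|.
    by apply: cvg_norm; apply: cvgB; [exact: cvg_cst|exact: Scvg].
  by move=> /cvgr_to_le; apply; exists n => // m; exact: Se.
exists f => [z|z]; last exact: Scvg.
apply/cvgrPdist_lt => r r0; have r30 : 0 < r / 3 by rewrite divr_gt0.
have [n en] := e_small _ r30.
have /cvgrPdist_lt /(_ _ r30) := cS n z.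
apply: filterS => y Sy.
have -> : f z - f y = (f z - S n z) + (S n z - S n y) + (S n y - f y).
  by rewrite !addrA !subrK.
have h1 := ler_normD (f z - S n z + (S n z - S n y)) (S n y - f y).
have h2 := ler_normD (f z - S n z) (S n z - S n y).
have h3 := Sf n z; have h4 := Sf n y; rewrite distrC in h3; lra.
Qed.

(** Scaling by [r / max(r, |v|)] fixes the ball of radius [r] and moves other points to its sphere;
    the denominator is at least [r]. *)
Lemma radial_retraction (R : realType) (M : normedModType R) (r : R) :
  0 < r -> exists rho : M -> M, [/\ continuous rho, forall v, `|rho v| <= r &
    forall v, `|v| <= r -> rho v = v].
Proof.
move=> r0; pose mx (v : M) : R := Num.max r `|v|.
have mx0 v : 0 < mx v by rewrite lt_max r0.
exists (fun v => (r / mx v) *: v); split=> [v|v|v vr].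
- apply: cvgZ => //; apply: cvgM; first exact: cvg_cst.
  apply: cvgV; first by rewrite gt_eqF.
  apply: (@continuous_max R M (fun=> r) (fun v => `|v|)); first exact: cvg_cst.
  exact: norm_continuous.
- have rm0 : 0 <= r / mx v by rewrite divr_ge0 ?ltW.
  rewrite normrZ (ger0_norm rm0) mulrAC ler_pdivrMr//.
  by rewrite ler_pM2l// le_max lexx orbT.
- by rewrite /mx max_l// divff ?gt_eqF// scale1r.
Qed.

Section FiniteValuedExtension.
Context (R : realType) (T : topologicalType) (M : completeNormedModType R).
Context (L : set T).
Context (sepL : forall A, A `<=` L -> exists phi : T -> R,
  [/\ continuous phi, forall z, A z -> phi z = 1 &
      forall z, (L `\` A) z -> phi z = 0]).

(** The extension is the sum of [phi v z *: v] over the distinct values [v], where on [L] the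
    function [phi v] is the indicator of [k = v]. *)
Lemma finite_valued_extension (k : T -> M) (s : seq M) :
  (forall z, L z -> k z \in s) ->
  exists2 F : T -> M, continuous F & forall z, L z -> F z = k z.
Proof.
move=> ks.
have /choice [phi phiP] : forall v, exists phi : T -> R, continuous phi /\
    forall z, L z -> phi z = (k z == v)%:R.
  move=> v; have [|phi [cphi phi1 phi0]] := sepL (A := [set z | L z /\ k z = v]).
    by move=> z [].
  exists phi; split => // z Lz; have [kv|/eqP kv] := eqVneq (k z) v.
    by rewrite phi1.
  by rewrite phi0//; split => // -[].
exists (fun z => \sum_(v <- undup s) phi v z *: v) => [|z Lz].
  elim: (undup s) => [|v t IH] z.
    by under eq_fun do rewrite big_nil; exact: cvg_cst.
  under eq_fun do rewrite big_cons; apply: cvgD; last exact: IH.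
  by apply: cvgZ; [exact: (phiP v).1|exact: cvg_cst].
rewrite (bigD1_seq (k z)) /= ?mem_undup ?undup_uniq ?ks//.
rewrite (phiP _).2// eqxx scale1r big1 ?addr0// => v vk.
by rewrite (phiP _).2// eq_sym (negbTE vk) scale0r.
Qed.

Lemma bounded_finite_valued_extension (k : T -> M) (s : seq M) (r : R) :
  0 < r -> (forall z, L z -> k z \in s /\ `|k z| <= r) ->
  exists F : T -> M, [/\ continuous F, forall z, L z -> F z = k z &
    forall z, `|F z| <= r].
Proof.
move=> r0 ks; have [|F cF FE] := @finite_valued_extension k s.
  by move=> z /ks [].
have [rho [crho rhor rhoE]] := @radial_retraction R M r r0.
exists (rho \o F); split=> [z|z Lz|z] //=.
  by apply: continuous_comp; [exact: cF|exact: crho].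
by rewrite FE// rhoE//; case: (ks z Lz).
Qed.

(** Finitely valued maps [a n] approximate [h] on [L] within [q n]. Their successive differences
    extend with a bound of order [q n] on all of [T], so the telescoping series converges uniformly,
    to [h] on [L]. *)
Lemma precompact_valued_extension (h : T -> M) : compact (closure (h @` L)) ->
  exists2 f : T -> M, continuous f & forall z, L z -> f z = h z.
Proof.
move=> ch; pose q n : R := (1 / 2) ^+ n.
have q0 n : 0 < q n by rewrite exprn_gt0.
have qS n : q n.+1 = q n / 2 by rewrite /q exprS mul1r mulrC.
have /choice [t tP] : forall n, exists t : seq M, forall v, closure (h @` L) v ->
    exists2 w, w \in t & `|v - w| < q n.
  by move=> n; exact: compact_finite_net.
have /choice [a aP] : forall nz : nat * T, exists w, L nz.2 ->
    w \in t nz.1 /\ `|h nz.2 - w| < q nz.1.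
  move=> [n z] /=; have [Lz|] := pselect (L z); last by exists 0.
  have [|w wt hw] := tP n (h z); first by apply: subset_closure; exists z.
  by exists w.
have [|F0 cF0 F0E] := @finite_valued_extension (fun z => a (0%N, z)) (t 0%N).
  by move=> z Lz; have [] := aP (0%N, z) Lz.
have /choice [F FP] : forall n, exists F : T -> M, [/\ continuous F,
    forall z, L z -> F z = a (n.+1, z) - a (n, z) & forall z, `|F z| <= 2 * q n].
  (* On [L] the difference is below [q n + q n.+1], hence below [2 * q n]. *)
  move=> n; apply: (@bounded_finite_valued_extension _
      [seq v - w | v <- t n.+1, w <- t n]); first by rewrite mulr_gt0.
  move=> z Lz; have [an han] := aP (n, z) Lz; have [aS haS] := aP (n.+1, z) Lz.
  split; first exact: allpairs_f.
  rewrite -[a (n.+1, z)](subrK (h z)) -addrA.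
  have := ler_normD (a (n.+1, z) - h z) (h z - a (n, z)).
  move: han haS (q0 n) => /=; rewrite qS [`|h z - a (n.+1, z)|]distrC; lra.
pose fix S n := if n is m.+1 then S m \+ F m else F0.
have cS n : continuous (S n).
  elim: n => //= n IH z; have [cF _ _] := FP n.
  by apply: cvgD; [exact: IH|exact: cF].
have SE n z : L z -> S n z = a (n, z).
  move=> Lz; elim: n => [|n IH] /=; rewrite ?F0E// IH.
  by have [_ -> // _] := FP n; rewrite addrC subrK.
(* The bounds telescope, since [2 * q i = 4 * q i - 4 * q i.+1]. *)
have Sdist n j z : `|S n z - S (n + j)%N z| <= 4 * q n - 4 * q (n + j)%N.
  elim: j => [|j IH]; first by rewrite addn0 !subrr normr0.
  rewrite addnS /= qS opprD addrA.
  have := ler_normB (S n z - S (n + j)%N z) (F (n + j)%N z).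
  have [_ _ /(_ z)] := FP (n + j)%N; lra.
have q_cvg : q @ \oo --> 0 by apply: cvg_expr; rewrite ger0_norm//; lra.
have [|n m z nm|f cf fS] :=
  uniformly_Cauchy_continuous_limit cS (e := fun n => 4 * q n).
- by rewrite -(mulr0 4); apply: cvgM; first exact: cvg_cst.
- have := Sdist n (m - n)%N z; have := q0 (n + (m - n))%N.
  by rewrite subnKC //; lra.
exists f => // z Lz; apply: (cvg_unique (@norm_hausdorff _ _) (fS z)).
apply/cvgrPdist_lt => e e0.
move/cvgr0_norm_lt: q_cvg => /(_ e e0); apply: filterS => n qe.
rewrite SE//; have [_ /lt_trans] := aP (n, z) Lz; apply.
exact: le_lt_trans (ler_norm _) qe.
Qed.

End FiniteValuedExtension.

(** A Urysohn function for the disjoint closed sets [D2] and [D1], composed with evaluation at [x],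
    is continuous on the power and splits [L] into [A] and its complement. *)
Lemma separated_interpolation (R : realType) (X : topologicalType)
    (M : completeNormedModType R) (L : set {ptws X -> M}) (Delta : set X) :
  separated_by (fun x y : M => `|x - y|) L Delta -> interpolation_set L.
Proof.
move=> sepL h ch; apply: precompact_valued_extension ch => A AL.
have [D1 [D2 [x [[clD1 clD2] _ D12 AD1 AD2]]]] := sepL A AL.
have D21 : D2 `&` D1 = set0.
  by rewrite setIC; apply: setdist_disjoint D12 => y; rewrite subrr normr0.
have [u [cu _ uD2 uD1]] := (uniform_separatorP (R := R) D2 D1).1
  ((normal_separatorP (R := R)).1 (@pseudometric_normal R M) _ _ clD2 clD1 D21).
exists (fun g => u (g x)); split=> [g|g Ag|g Lg].
- by apply: continuous_comp; [exact: ptws_eval_continuous|exact: cu].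
- by apply: uD1; exists (g x) => //; exact: AD1.
- by apply: uD2; exists (g x) => //; exact: AD2.
Qed.

(** * Metric and Banach spaces as targets *)

Lemma mdist_is_distance (R : realType) (M : metricType R) :
  is_distance (fun x y : M => mdist x y).
Proof.
split.
- by move=> x y; split=> [/mdist_positivity|->]; last exact: mdistxx.
- exact: metric_sym.
- by move=> x y z; exact: metric_triangle.
- by move=> x; rewrite metricType_numDomainType.filter_from_mdist_nbhs.
Qed.

Lemma norm_is_distance (R : realType) (M : normedModType R) :
  is_distance (fun x y : M => `|x - y|).
Proof.
split.
- move=> x y; split=> [/eqP|->]; last by rewrite subrr normr0.
  by rewrite normr_eq0 subr_eq0 => /eqP.
- exact: distrC.
- by move=> x y z; exact: ler_distD.
- by move=> x; rewrite -filter_from_norm_nbhs.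
Qed.

Theorem theorem1 (R : realType) (X Y : topologicalType) (Phi : X -> Y)
  (infX : infinite_set [set: X])
  (crX : completely_regular_space X) (hausX : hausdorff_space X)
  (cechX : Cech_complete R X)
  (infY : infinite_set [set: Y])
  (metrY : metrizable R Y) (sepY : separable Y)
  (contPhi : continuous Phi) (qoPhi : quasi_open Phi) :
  (forall (M : metricType R) (G : set {ptws X -> M}),
      infinite_set [set: M] ->
      G `<=` Cfun X M ->
      B_family (fun x y : M => mdist x y) G ->
      (forall g, G g -> factors_through Phi g) ->
      exists Delta : set X, exists L : set {ptws X -> M},
        [/\ Delta !=set0, compact Delta, L `<=` G,
            countable L /\ infinite_set L &
            separated_by (fun x y : M => mdist x y) L Delta]) /\
  (forall (M : completeNormedModType R) (G : set {ptws X -> M}),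
      infinite_set [set: M] ->
      G `<=` Cfun X M ->
      B_family (fun x y : M => `|x - y|) G ->
      (forall g, G g -> factors_through Phi g) ->
      exists L : set {ptws X -> M},
        [/\ L `<=` G, countable L /\ infinite_set L & interpolation_set L]).
Proof.
have Y0 := infinite_setN0 infY; have [dY ddY] := metrY.
split=> M G _ Gc BG GPhi.
  exact: (separated_subset crX cechX ddY sepY Y0 contPhi qoPhi
    (mdist_is_distance M) Gc BG GPhi).
have [Delta [L [_ _ LG iL /separated_interpolation]]] :=
  separated_subset crX cechX ddY sepY Y0 contPhi qoPhi
    (norm_is_distance M) Gc BG GPhi.
by exists L.
Qed.
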